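(* Consider a generalized Nash equilibrium problem with costs $J_i$, shared equality constraints $A\mathbf x=\mathbf b$ and shared inequality constraints $\mathbf g(\mathbf x)\le\mathbf 0$ such that: the pseudo-gradient $\mathbf F$ is strongly monotone, i.e. there is $m_F>0$ with $(\mathbf F(\mathbf x)-\mathbf F(\mathbf y))^\top(\mathbf x-\mathbf y)\ge m_F\|\mathbf x-\mathbf y\|^2$ for all $\mathbf x,\mathbf y\in\mathbb R^n$; the functions $J_i$ and $\mathbf g$ are twice continuously differentiable, $A$ has full row rank and each component $g_j$ is convex; there is $\bar{\mathbf x}$ with $A\bar{\mathbf x}=\mathbf b$ and $\mathbf g(\bar{\mathbf x})<\mathbf 0$ componentwise; and the shared feasible set $\{\mathbf x:A\mathbf x=\mathbf b,\ \mathbf g(\mathbf x)\le\mathbf 0\}$ is bounded. Fix $\epsilon>0$, $T>0$, $\mu_c>0$, and let $\mathbf S$, $V$, $\Omega_c$ and $c^*$ be as defined in the context. Consider the dynamics $$\dot{\mathbf z}(t)=-\frac{\mu_c}{T-t}\,\nabla V(\mathbf z(t)),\qquad t\in[0,T).$$ If $V(\mathbf z(0))<c^*$, then: (i) All trajectories remain bounded: $\mathbf z(t)\in\Omega_{V(\mathbf z(0))}$ for all $t\in[0,T)$. (ii) For all $t\in[0,T)$, $$V(\mathbf z(t))\le V(\mathbf z(0))\left(\frac{T-t}{T}\right)^{\gamma},\qquad \gamma=2\underline\sigma^2\mu_c,$$ where $\underline\sigma=\min_{\mathbf z\in\Omega_{V(\mathbf z(0))}}\sigma_{\min}(\nabla\mathbf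 S(\mathbf z))>0$ and $\sigma_{\min}$ denotes the smallest singular value. (iii) Consequently, $\lim_{t\to T^-}V(\mathbf z(t))=0$, and as $t\to T^-$ the state $\mathbf z(t)$ converges to the unique zero of $\mathbf S$.
   Context: **Game.** Agents $i=1,\dots,N$ have decisions $\mathbf x_i\in\mathbb R^{n_i}$; $\mathbf x=\mathrm{col}(\mathbf x_1,\dots,\mathbf x_N)\in\mathbb R^n$, $n=\sum_i n_i$. Agent $i$ minimizes $J_i(\mathbf x_i,\mathbf x_{-i})$ over $\mathbf x_i$ subject to $A\mathbf x=\mathbf b$ ($A\in\mathbb R^{m\times n}$, $\mathbf b\in\mathbb R^m$) and $\mathbf g(\mathbf x)\le\mathbf 0$ ($\mathbf g:\mathbb R^n\to\mathbb R^p$). The pseudo-gradient is $\mathbf F(\mathbf x)=\mathrm{col}(\nabla_{\mathbf x_1}J_1(\mathbf x),\dots,\nabla_{\mathbf x_N}J_N(\mathbf x))$. **Stationarity vector and function $V$.** For $\mathbf z=\mathrm{col}(\mathbf x,\boldsymbol\lambda,\boldsymbol\mu)\in\mathbb R^{n+p+m}$ and fixed $\epsilon>0$, $$\mathbf S(\mathbf z)=\begin{bmatrix}\mathbf F(\mathbf x)+\nabla\mathbf g(\mathbf x)^\top\widetilde{\boldsymbol\lambda}+A^\top\boldsymbol\mu\\ A\mathbf x-\mathbf b\\ \Phi_\epsilon(\boldsymbol\lambda,-\mathbf g(\mathbf x))\end{bmatrix},\qquad V(\mathbf z)=\tfrac12\|\mathbf S(\mathbf z)\|^2,$$ where $\nabla\mathbf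 g$ is the $p\times n$ Jacobian of $\mathbf g$, $\widetilde\lambda_j=\frac12(\sqrt{\lambda_j^2+\epsilon^2}+\lambda_j)$ for $j=1,\dots,p$, and $\Phi_\epsilon(a,b)=\sqrt{a^2+b^2+\epsilon^2}-(a+b)$ is applied componentwise. $\nabla\mathbf S$ denotes the Jacobian of $\mathbf S$, so $\nabla V=\nabla\mathbf S^\top\mathbf S$. **Sublevel sets and threshold.** $\Omega_c=\{\mathbf z\in\mathbb R^{n+p+m}:V(\mathbf z)\le c\}$. The number $c^*\in(0,+\infty]$ is a threshold such that $\Omega_c$ is compact for all $0<c<c^*$ (under the hypotheses of the claim such a threshold is known to exist; if $\mathbf g(\mathbf x)=\mathbf C\mathbf x-\mathbf d$ with $\mathbf C$ of full row rank, one takes $c^*=+\infty$). *)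

(* Defs.v *)
From HB Require Import structures.
From mathcomp Require Import all_boot all_order all_algebra.
From mathcomp Require Import all_classical all_reals all_analysis.

Set Implicit Arguments.
Unset Strict Implicit.
Unset Printing Implicit Defensive.
Import Order.TTheory GRing.Theory Num.Theory.
Import numFieldNormedType.Exports.

Local Open Scope classical_set_scope.
Local Open Scope ring_scope.

(* Vectors of R^n are row vectors 'rV[R]_n, as required by 'J f x: a column
   equation M^T u of the mathematics reads u *m M here, and M u reads
   u *m M^T. *)

Section Euclidean.
Context {R : realType}.

Definition dot n (u v : 'rV[R]_n) : R := \sum_i u 0 i * v 0 i.

(* The Euclidean norm; the norm `|_| of the library on matrices is the
   sup norm (which induces the same topology and bounded sets). *)
Definition norm2 n (u : 'rV[R]_n) : R := Num.sqrt (dot u u).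

(* Nonnegative square roots of the eigenvalues of M^T M; these are the
   singular values of M when M has at least as many rows as columns. *)
Definition singular_values k l (M : 'M[R]_(k, l)) : set R :=
  [set s | 0 <= s /\ eigenvalue (M^T *m M) (s ^+ 2)].

(* For 0 < l <= k the set of singular values is finite and nonempty, so that
   this infimum is its minimum. *)
Definition sigma_min k l (M : 'M[R]_(k, l)) : R := inf (singular_values M).

Definition is_minimum (E : set R) (s : R) := E s /\ lbound E s.

End Euclidean.

Section Calculus.
Context {R : realType}.

Definition gradient n (f : 'rV[R]_n -> R^o) (x : 'rV[R]_n) : 'rV[R]_n :=
  \row_k 'D_(delta_mx 0 k) f x.

(* The q x n Jacobian matrix, with entry (i, j) the j-th partial derivative of
   the i-th component; 'J f x, which acts on the right of row vectors, is its
   transpose. *)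
Definition Jac n q (f : 'rV[R]_n -> 'rV[R]_q) (x : 'rV[R]_n) : 'M[R]_(q, n) :=
  ('J f x)^T.

Fixpoint times_cont_diff (k : nat) {V W : normedModType R} (f : V -> W) : Prop :=
  if k is k'.+1 then
    (forall x, differentiable f x) /\ (forall v, times_cont_diff k' ('D_v f))
  else continuous f.

Definition strongly_monotone n (F : 'rV[R]_n -> 'rV[R]_n) : Prop :=
  exists2 m : R, 0 < m &
    forall x y, m * norm2 (x - y) ^+ 2 <= dot (F x - F y) (x - y).

(* The derivative of z at t relative to the domain D; it is one-sided at an
   endpoint of an interval. *)
Definition has_derivative_within {V : normedModType R} (D : set R)
    (z : R -> V) (t : R) (l : V) : Prop :=
  (s - t)^-1 *: (z s - z t) @[s --> within D t^'] --> l.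

Definition solution_flow n (W : 'rV[R]_n -> R^o) (mu_c T : R)
    (z : R -> 'rV[R]_n) : Prop :=
  forall t, 0 <= t < T ->
    has_derivative_within `[0, T[ z t
      (- (mu_c / (T - t)) *: gradient W (z t)).

End Calculus.

Section Game.
Context {R : realType}.

(* The block submxrow x i of x : 'rV_(\sum_i d i) is the decision of agent i;
   the gradient of J i in that block consists of the partial derivatives of
   J i along its coordinates. *)
Definition pseudo_gradient N (d : 'I_N -> nat)
    (J : 'I_N -> 'rV[R]_(\sum_i d i) -> R^o) (x : 'rV[R]_(\sum_i d i)) :
    'rV[R]_(\sum_i d i) :=
  \mxrow_i submxrow (gradient (J i) x) i.

Definition lambda_tilde (eps : R) p (lam : 'rV[R]_p) : 'rV[R]_p :=
  \row_j (2^-1 * (Num.sqrt (lam 0 j ^+ 2 + eps ^+ 2) + lam 0 j)).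

Definition Phi (eps : R) p (a b : 'rV[R]_p) : 'rV[R]_p :=
  \row_j (Num.sqrt (a 0 j ^+ 2 + b 0 j ^+ 2 + eps ^+ 2) - (a 0 j + b 0 j)).

Section Stationarity.
Context {n p m : nat}.
Variables (F : 'rV[R]_n -> 'rV[R]_n) (g : 'rV[R]_n -> 'rV[R]_p).
Variables (A : 'M[R]_(m, n)) (b : 'rV[R]_m) (eps : R).

(* z = (x, lam, mu); the blocks of the values have sizes n, m and p. *)
Definition Smap (z : 'rV[R]_(n + p + m)) : 'rV[R]_(n + m + p) :=
  let x := lsubmx (lsubmx z) in
  let lam := rsubmx (lsubmx z) in
  let mu := rsubmx z in
  row_mx
    (row_mx (F x + lambda_tilde eps lam *m Jac g x + mu *m A)
            (x *m A^T - b))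
    (Phi eps lam (- g x)).

Definition Vfun (z : 'rV[R]_(n + p + m)) : R^o :=
  2^-1 * norm2 (Smap z) ^+ 2.

Definition Omega (c : R) : set 'rV[R]_(n + p + m) := [set z | Vfun z <= c].

End Stationarity.
End Game.

(* Main.v *)
(** The heart of the matter is the invertibility of the Jacobian of S. If
    v = (a, l, u) is in its kernel, the perturbed complementarity rows force l_j
    to be a positive multiple of the derivative of g_j along a, the equality
    rows give A a = 0, and pairing the stationarity rows with a leaves a sum of
    nonnegative terms dominating m_F |a|^2. So the least singular value is
    bounded below by some sigma > 0 on the compact sublevel set, whence
    |grad V|^2 >= 2 sigma^2 V there, and V(z(t)) (T - t)^(- gamma) is
    nonincreasing. A cluster point of the trajectory is then a zero of S; zeros
    are unique by strong monotonicity of F and convexity of g, because S = 0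
    makes g_j an increasing function of lambda_j. *)

Require Import Defs.
From HB Require Import structures.
From mathcomp Require Import all_boot all_order all_algebra.
From mathcomp Require Import all_classical all_reals all_analysis.
From mathcomp Require Import ring lra.

Set Implicit Arguments.
Unset Strict Implicit.
Unset Printing Implicit Defensive.
Import Order.TTheory GRing.Theory Num.Theory.
Import numFieldNormedType.Exports.

Local Open Scope classical_set_scope.
Local Open Scope ring_scope.

(** * Euclidean inner product and compactness of the unit sphere *)

Section DotProduct.
Context {R : realType}.

Lemma dotC n (u v : 'rV[R]_n) : dot u v = dot v u.
Proof. by apply: eq_bigr => i _; rewrite mulrC. Qed.

Lemma dotDl n (u v w : 'rV[R]_n) : dot (u + v) w = dot u w + dot v w.
Proof. by rewrite -big_split; apply: eq_bigr => i _; rewrite mxE mulrDl. Qed.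

Lemma dotZl n a (u w : 'rV[R]_n) : dot (a *: u) w = a * dot u w.
Proof. by rewrite /dot mulr_sumr; apply: eq_bigr => i _; rewrite mxE mulrA. Qed.

Lemma dotDr n (u v w : 'rV[R]_n) : dot w (u + v) = dot w u + dot w v.
Proof. by rewrite dotC dotDl !(dotC _ w). Qed.

Lemma dotZr n a (u w : 'rV[R]_n) : dot w (a *: u) = a * dot w u.
Proof. by rewrite dotC dotZl dotC. Qed.

Lemma dotNl n (u w : 'rV[R]_n) : dot (- u) w = - dot u w.
Proof. by rewrite -scaleN1r dotZl mulN1r. Qed.

Lemma dotBl n (u v w : 'rV[R]_n) : dot (u - v) w = dot u w - dot v w.
Proof. by rewrite dotDl dotNl. Qed.

Lemma dot0l n (u : 'rV[R]_n) : dot 0 u = 0.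
Proof. by rewrite -(scale0r u) dotZl mul0r. Qed.

Lemma dot_suml n k (f : 'I_k -> 'rV[R]_n) w :
  dot (\sum_j f j) w = \sum_j dot (f j) w.
Proof.
elim/big_ind2 : _ => [|u a v c <- <-|//]; first exact: dot0l.
exact: dotDl.
Qed.

Lemma dot_mulmxl n k (u : 'rV[R]_n) (M : 'M[R]_(n, k)) w :
  dot (u *m M) w = dot u (w *m M^T).
Proof.
rewrite /dot; under eq_bigr do rewrite mxE mulr_suml.
rewrite exchange_big /=; apply: eq_bigr => i _.
by rewrite mxE mulr_sumr; apply: eq_bigr => j _; rewrite mxE mulrCA mulrC mulrA.
Qed.

Lemma dot_ge0 n (u : 'rV[R]_n) : 0 <= dot u u.
Proof. by apply: sumr_ge0 => i _; rewrite -expr2 sqr_ge0. Qed.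

Lemma dot_eq0 n (u : 'rV[R]_n) : (dot u u == 0) = (u == 0).
Proof.
apply/eqP/eqP => [u0|->]; last by rewrite dot0l.
apply/rowP => i; rewrite mxE; apply/eqP; rewrite -sqrf_eq0; apply/eqP.
have sq0 j : true -> 0 <= u 0 j * u 0 j by rewrite -expr2 sqr_ge0.
exact: psumr_eq0P sq0 u0 i isT.
Qed.

Lemma dot_gt0 n (u : 'rV[R]_n) : u != 0 -> 0 < dot u u.
Proof. by move=> u0; rewrite lt_neqAle dot_ge0 eq_sym dot_eq0 u0. Qed.

Lemma norm2_sqr n (u : 'rV[R]_n) : norm2 u ^+ 2 = dot u u.
Proof. by rewrite sqr_sqrtr// dot_ge0. Qed.

Lemma norm2_gt0 n (u : 'rV[R]_n) : u != 0 -> 0 < norm2 u.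
Proof. by move=> u0; rewrite sqrtr_gt0 dot_gt0. Qed.

Lemma dot_normalize n (u : 'rV[R]_n) : u != 0 ->
  dot ((norm2 u)^-1 *: u) ((norm2 u)^-1 *: u) = 1.
Proof.
move=> u0; rewrite dotZl dotZr -norm2_sqr.
by rewrite expr2 mulKf ?mulVf// gt_eqF// norm2_gt0.
Qed.

(** Expand the square of the vector [dot v v *: u - dot u v *: v], which is nonnegative, and cancel
    the positive factor [dot v v]. *)
Lemma dot_CauchySchwarz n (u v : 'rV[R]_n) : dot u v ^+ 2 <= dot u u * dot v v.
Proof.
have [->|v0] := eqVneq v 0; first by rewrite dotC !dot0l expr0n mulr0.
have vv := dot_gt0 v0.
have := dot_ge0 (dot v v *: u - dot u v *: v).
rewrite !(dotBl, dotZl, dotDr, dotZr) -scaleN1r !dotZr (dotC v u).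
set a := dot u v; set b := dot v v in vv *; set c := dot u u.
have -> : b * (b * c + -1 * (a * a)) - a * (b * a + -1 * (a * b))
  = b * (c * b - a ^+ 2) by rewrite expr2; ring.
by rewrite pmulr_rge0// subr_ge0.
Qed.

Lemma continuous_sum (T : topologicalType) (I : Type) (r : seq I)
    (F : I -> T -> R) :
  (forall i, continuous (F i)) -> continuous (fun x => \sum_(i <- r) F i x).
Proof. by move=> cF; apply: continuous_big => //; exact: add_continuous. Qed.

Lemma continuous_dot (T : topologicalType) n (f g : T -> 'rV[R]_n) :
  (forall i, continuous (fun x => f x 0 i)) ->
  (forall i, continuous (fun x => g x 0 i)) ->
  continuous (fun x => dot (f x) (g x)).
Proof.
move=> cf cg; apply: continuous_sum => i x.
by apply: cvgM; [exact: cf|exact: cg].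
Qed.

Definition unit_sphere n : set 'rV[R]_n := [set v | dot v v = 1].

Lemma unit_sphere_nonempty n : (0 < n)%N -> @unit_sphere n !=set0.
Proof.
case: n => // n _; pose u : 'rV[R]_n.+1 := const_mx 1.
exists ((norm2 u)^-1 *: u).
apply: dot_normalize; apply/eqP => /rowP/(_ 0); rewrite !mxE.
exact/eqP/oner_neq0.
Qed.

(** Boundedness refers to the sup norm, so it is enough that the square of one coordinate is at most
    the whole sum of squares. *)
Lemma compact_unit_sphere n : compact (@unit_sphere n).
Proof.
apply: bounded_closed_compact.
  exists 1; split=> // M M1 v /= v1; apply: le_trans (ltW M1).
  rewrite [leLHS]/Num.Def.normr/= mx_normrE; apply: bigmax_le => // -[i j] _ /=.
  rewrite (ord1 i) -(@expr_le1 _ 2)// -normrX ger0_norm ?sqr_ge0//.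
  rewrite -v1 /dot (bigD1 j)//= expr2 lerDl sumr_ge0// => k _.
  by rewrite -expr2 sqr_ge0.
apply: (@closed_comp _ _ (fun v => dot v v) [set 1]).
  by move=> v _; apply: continuous_dot => i; exact: coord_continuous.
exact: closed_eq.
Qed.

End DotProduct.

(** * The smallest singular value as a minimum of the Rayleigh quotient *)

Section SmallestSingularValue.
Context {R : realType}.

(* The minimiser of the Rayleigh quotient is an eigenvector: [Q] is positive
   semidefinite with [v Q v^T = 0], so the quadratic polynomial
   [t |-> (v + t w) Q (v + t w)^T >= 0] has no linear term. *)
Lemma psd_isotropic_kernel n (Q : 'M[R]_n) (v : 'rV[R]_n) :
  Q^T = Q -> (forall w, 0 <= dot (w *m Q) w) -> dot (v *m Q) v = 0 ->
  v *m Q = 0.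
Proof.
move=> QT Q0 vQv; apply/eqP; rewrite -dot_eq0; set w := v *m Q.
apply/negPn/negP => ww; have {}ww : 0 < dot w w by rewrite dot_gt0// -dot_eq0.
have wQw := Q0 w.
have h t : 0 <= t * (t * dot (w *m Q) w + 2 * dot w w).
  have := Q0 (v + t *: w).
  rewrite mulmxDl -scalemxAl !(dotDl, dotDr, dotZl, dotZr) vQv -/w.
  rewrite (_ : dot (w *m Q) v = dot w w); last by rewrite dot_mulmxl QT.
  by congr (_ <= _); ring.
(* With a = |w|^2 and b = w Q w^T >= 0, the polynomial is negative at t = - a / (1 + b), where it
   equals - t^2 (2 + b); the 1 in the denominator covers b = 0. *)
have := h (- (dot w w / (1 + dot (w *m Q) w))).
set a := dot w w in ww *; set b := dot _ _ in wQw *.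
have b1 : 0 < 1 + b by lra.
have -> : - (a / (1 + b)) * (- (a / (1 + b)) * b + 2 * a) =
  - ((a / (1 + b)) ^+ 2 * (2 + b)) by field; rewrite gt_eqF.
by rewrite oppr_ge0 leNgt mulr_gt0 ?exprn_gt0 ?divr_gt0//; lra.
Qed.

(** The minimum c of |M v|^2 over the unit sphere exists by compactness and is the least eigenvalue
    of M^T M. This identifies the infimum in [sigma_min] with the square root of c and supplies both
    the bound and a vector attaining it. *)
Lemma sigma_min_spec k l (M : 'M[R]_(k, l)) : (0 < l)%N ->
  [/\ 0 <= sigma_min M,
      forall w, sigma_min M ^+ 2 * dot w w <= dot (w *m M^T) (w *m M^T) &
      exists2 v, dot v v = 1 & dot (v *m M^T) (v *m M^T) = sigma_min M ^+ 2].
Proof.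
move=> l0.
have [|v vS vmin] := compact_EVT_min (@unit_sphere_nonempty R l l0)
    (@compact_unit_sphere R l)
    (f := fun v : 'rV[R]_l => dot (v *m M^T) (v *m M^T)).
  apply: continuous_subspaceT; apply: continuous_dot => i;
    under eq_fun do rewrite mxE; apply: continuous_sum => j x;
    by apply: continuousM; [exact: coord_continuous|exact: cst_continuous].
rewrite inE /unit_sphere/= in vS.
set c := dot (v *m M^T) (v *m M^T) in vmin.
have c0 : 0 <= c by exact: dot_ge0.
(* Homogeneity extends the bound from unit vectors to all vectors. *)
have cmin w : c * dot w w <= dot (w *m M^T) (w *m M^T).
  have [->|w0] := eqVneq w 0; first by rewrite mul0mx !dot0l mulr0.
  have /vmin : (norm2 w)^-1 *: w \in @unit_sphere R l.
    by rewrite inE; exact: dot_normalize.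
  rewrite -scalemxAl dotZl dotZr mulrA -expr2 exprVn mulrC.
  by rewrite ler_pdivlMr ?exprn_gt0 ?norm2_gt0// norm2_sqr.
have dotMM w : dot (w *m (M^T *m M)) w = dot (w *m M^T) (w *m M^T).
  by rewrite mulmxA dot_mulmxl.
(* The shifted matrix M^T M - c I is positive semidefinite and isotropic at [v], so [v] is an
   eigenvector for c. *)
have vker : v *m (M^T *m M - c%:M) = 0.
  apply: psd_isotropic_kernel => [|w|].
  - by rewrite linearB/= trmx_mul trmxK tr_scalar_mx.
  - by rewrite mulmxBr mul_mx_scalar dotBl dotZl dotMM subr_ge0.
  - by rewrite mulmxBr mul_mx_scalar dotBl dotZl dotMM vS mulr1 subrr.
have csv : singular_values M (Num.sqrt c).
  split; first exact: sqrtr_ge0.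
  rewrite sqr_sqrtr//; apply/eigenvalueP; exists v.
    by apply/eqP; rewrite -subr_eq0 -mul_mx_scalar -mulmxBr vker.
  by rewrite -dot_eq0 vS oner_eq0.
(* The square of any singular value is the Rayleigh quotient of its eigenvector, hence at least
   c. *)
have clb : lbound (singular_values M) (Num.sqrt c).
  move=> s [s0 /eigenvalueP[w ws w0]].
  rewrite -(@ler_pXn2r _ 2)// ?nnegrE ?sqrtr_ge0// sqr_sqrtr//.
  have := cmin w; rewrite -dotMM ws dotZl ler_pM2r// dot_gt0//.
have -> : sigma_min M = Num.sqrt c.
  apply/eqP; rewrite eq_le; apply/andP; split.
    by apply: ge_inf => //; exists (Num.sqrt c).
  by apply: lb_le_inf => //; exists (Num.sqrt c).
split; [exact: sqrtr_ge0|by rewrite sqr_sqrtr|].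
by exists v => //; rewrite sqr_sqrtr.
Qed.

Lemma sigma_min_ge k l (M : 'M[R]_(k, l)) c : (0 < l)%N -> 0 <= c ->
  (forall v, dot v v = 1 -> c ^+ 2 <= dot (v *m M^T) (v *m M^T)) ->
  c <= sigma_min M.
Proof.
move=> l0 c0 cM; have [s0 _ [v v1 vE]] := sigma_min_spec M l0.
by rewrite -ler_sqr ?nnegrE// -vE cM.
Qed.

(* Write [w = M v] and use Cauchy-Schwarz in [|w|^2 = <v, M^T w>]. *)
Lemma transpose_lower_bound k l (M : 'M[R]_(k, l)) (s : R) : k = l -> 0 < s ->
  (forall v, s * dot v v <= dot (v *m M^T) (v *m M^T)) ->
  forall w, s * dot w w <= dot (w *m M) (w *m M).
Proof.
move=> kl; case: _ / kl in M * => s0 sM w.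
(* The lower bound makes M injective; being square, it is then surjective, so that [w] has a
   preimage. *)
have Mfree : row_free M^T.
  apply/inj_row_free => v vM; apply/eqP; rewrite -dot_eq0 eq_le dot_ge0 andbT.
  by have := sM v; rewrite vM dot0l pmulr_rle0.
have [v wE] : exists v, w = v *m M^T.
  have /submxP[v ->] : (w <= M^T)%MS; last by exists v.
  by apply: submx_full; exact: Mfree.
have [->|w0] := eqVneq w 0; first by rewrite mul0mx !dot0l mulr0.
have ww := dot_gt0 w0.
have wv : dot w w = dot (w *m M) v by rewrite dot_mulmxl -wE.
have cs := dot_CauchySchwarz (w *m M) v; rewrite -wv in cs.
have sv := sM v; rewrite -wE in sv.
have a0 := dot_ge0 (w *m M).
rewrite -(ler_pM2r ww).
have : dot w w ^+ 2 * s <= dot (w *m M) (w *m M) * dot w w.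
  apply: le_trans (ler_wpM2r (ltW s0) cs) _.
  by rewrite -mulrA ler_wpM2l// mulrC.
by rewrite (_ : s * _ * _ = dot w w ^+ 2 * s)//; ring.
Qed.

End SmallestSingularValue.

(** * Calculus of continuously differentiable functions, Jacobians and gradients *)

Section ContinuouslyDifferentiable.
Context {R : realType}.
Implicit Types V W : normedModType R.

Lemma times_cont_diffS k V W (f : V -> W) :
  times_cont_diff k.+1 f -> times_cont_diff k f.
Proof.
elim: k W f => [|k IHk] W f [df Df].
  by move=> x; exact: differentiable_continuous.
by split=> // v; apply: IHk; exact: Df.
Qed.

Lemma C1_cst V (c : R) : times_cont_diff 1 (cst c : V -> R^o).
Proof.
split=> [x|v]; first exact: differentiable_cst.
rewrite (_ : 'D_v _ = cst 0); first exact: cst_continuous.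
by apply/funext => x; rewrite derive_cst.
Qed.

Lemma C1D V (f g : V -> R^o) : times_cont_diff 1 f -> times_cont_diff 1 g ->
  times_cont_diff 1 (fun x => f x + g x : R^o).
Proof.
move=> [df Df] [dg Dg]; split=> [x|v]; first exact: differentiableD.
rewrite (_ : 'D_v _ = fun x => 'D_v f x + 'D_v g x).
  by move=> x; apply: cvgD; [exact: Df|exact: Dg].
by apply/funext => x; rewrite deriveD//; exact: diff_derivable.
Qed.

Lemma C1M V (f g : V -> R^o) : times_cont_diff 1 f -> times_cont_diff 1 g ->
  times_cont_diff 1 (fun x => f x * g x : R^o).
Proof.
move=> [df Df] [dg Dg]; split=> [x|v]; first exact: differentiableM.
rewrite (_ : 'D_v _ = fun x => f x * 'D_v g x + g x * 'D_v f x).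
  have cf x := differentiable_continuous (df x).
  have cg x := differentiable_continuous (dg x).
  move=> x; apply: cvgD.
    by apply: cvgM; [exact: cf|exact: Dg].
  by apply: cvgM; [exact: cg|exact: Df].
by apply/funext => x; rewrite deriveM//; exact: diff_derivable.
Qed.

Lemma C1N V (f : V -> R^o) : times_cont_diff 1 f ->
  times_cont_diff 1 (fun x => - f x : R^o).
Proof.
move=> C1f; under eq_fun do rewrite -mulN1r; apply: C1M => //; exact: C1_cst.
Qed.

Lemma C1B V (f g : V -> R^o) : times_cont_diff 1 f -> times_cont_diff 1 g ->
  times_cont_diff 1 (fun x => f x - g x : R^o).
Proof. by move=> C1f C1g; apply: C1D => //; exact: C1N. Qed.

Lemma C1_sum V n (F : 'I_n -> V -> R^o) : (forall i, times_cont_diff 1 (F i)) ->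
  times_cont_diff 1 (fun x => \sum_i F i x : R^o).
Proof.
move=> C1F; elim: n F C1F => [|n IHn] F C1F.
  by under eq_fun do rewrite big_ord0; exact: C1_cst.
by under eq_fun do rewrite big_ord_recl; apply: C1D => //; exact: IHn.
Qed.

Lemma derive_sqrt V (f : V -> R^o) x v : differentiable f x -> 0 < f x ->
  'D_v (fun y => Num.sqrt (f y) : R^o) x = (2 * Num.sqrt (f x))^-1 * 'D_v f x.
Proof.
move=> df f0.
have [ds sE] := is_derive1_sqrt f0.
have dS : differentiable (Num.sqrt : R -> R^o) (f x) by exact/derivable1_diffP.
rewrite (deriveE _ dS) in sE.
rewrite deriveE; last exact: (@differentiable_comp _ _ _ _ f).
rewrite (@diff_comp _ _ _ _ f)//= (deriveE v df) -sE mulrC.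
set h : R^o := 'd f x v; rewrite -[in LHS](mulr1 h).
by rewrite [LHS]linearZ_LR.
Qed.

(** Strict positivity keeps [f] away from 0, where the square root is not differentiable. *)
Lemma C1_sqrt V (f : V -> R^o) : times_cont_diff 1 f -> (forall x, 0 < f x) ->
  times_cont_diff 1 (fun x => Num.sqrt (f x) : R^o).
Proof.
move=> [df Df] f0.
have ds x : differentiable (fun x => Num.sqrt (f x) : R^o) x.
  apply: (@differentiable_comp _ _ _ _ f) => //.
  by apply/derivable1_diffP; have [] := is_derive1_sqrt (f0 x).
split=> // v.
rewrite (_ : 'D_v _ = fun x => (2 * Num.sqrt (f x))^-1 * 'D_v f x).
  move=> x; apply: cvgM; last exact: Df.
  apply: cvgV; first by rewrite mulf_neq0// gt_eqF// sqrtr_gt0.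
  by apply: cvgM; [exact: cvg_cst|exact: differentiable_continuous (ds x)].
by apply/funext => x; rewrite derive_sqrt.
Qed.

Lemma derive_comp_linear V W (f : W -> R^o) (L : {linear V -> W}) x v :
  continuous L -> differentiable f (L x) ->
  'D_v (fun y => f (L y) : R^o) x = 'D_(L v) f (L x).
Proof.
move=> cL df; have dL := linear_differentiable x cL.
rewrite deriveE; last exact: (@differentiable_comp _ _ _ _ L).
by rewrite (@diff_comp _ _ _ _ L)//= diff_lin// -deriveE.
Qed.

Lemma C1_comp_linear V W (f : W -> R^o) (L : {linear V -> W}) :
  continuous L -> times_cont_diff 1 f ->
  times_cont_diff 1 (fun x => f (L x) : R^o).
Proof.
move=> cL [df Df]; split=> [x|v].
  apply: (@differentiable_comp _ _ _ _ L) => //.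
  exact: linear_differentiable.
rewrite (_ : 'D_v _ = 'D_(L v) f \o L).
  by move=> x; apply: continuous_comp; [exact: cL|exact: Df].
by apply/funext => x; rewrite derive_comp_linear.
Qed.

Lemma derive_coord V n (f : V -> 'rV[R]_n) x v j : differentiable f x ->
  'D_v (fun y => f y 0 j : R^o) x = ('D_v f x) 0 j.
Proof. by move=> df; rewrite derive_mx ?mxE//; exact: diff_derivable. Qed.

Lemma C1_coord n j : times_cont_diff 1 (fun x : 'rV[R]_n => x 0 j : R^o).
Proof.
split=> [x|v]; first exact: differentiable_coord.
rewrite (_ : 'D_v _ = cst (v 0 j)); first exact: cst_continuous.
by apply/funext => x; rewrite derive_coord// derive_id.
Qed.

Lemma times_cont_diff_coord k V n (f : V -> 'rV[R]_n) j :
  times_cont_diff k f -> times_cont_diff k (fun x => f x 0 j : R^o).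
Proof.
elim: k f => [|k IHk] f /= => [cf x|[df Df]].
  apply: (@continuous_comp _ _ _ f (fun u : 'rV[R]_n => u 0 j)).
    exact: cf.
  exact: coord_continuous.
split=> [x|v].
  by apply: (@differentiable_comp _ _ _ _ f (fun u : 'rV[R]_n => u 0 j)) => //;
    exact: differentiable_coord.
rewrite (_ : 'D_v _ = fun x => 'D_v f x 0 j); first exact: IHk.
by apply/funext => x; rewrite derive_coord.
Qed.

Lemma differentiable_rV V n (f : V -> 'rV[R]_n) x :
  (forall j, differentiable (fun y => f y 0 j : R^o) x) -> differentiable f x.
Proof.
move=> df.
rewrite (_ : f = \sum_j (fun y => f y 0 j *: delta_mx 0 j)).
  by apply: differentiable_sum => j; exact: differentiableZl.
by apply/funext => y; rewrite fct_sumE [LHS]row_sum_delta.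
Qed.

Lemma mulmx_tr_Jac n q (f : 'rV[R]_n -> 'rV[R]_q) x v :
  differentiable f x -> v *m (Jac f x)^T = 'D_v f x.
Proof. by move=> df; rewrite trmxK deriveEjacobian. Qed.

Lemma JacE n q (f : 'rV[R]_n -> 'rV[R]_q) x i k : differentiable f x ->
  Jac f x i k = 'D_(delta_mx 0 k) (fun y => f y 0 i : R^o) x.
Proof.
by move=> df; rewrite derive_coord// -mulmx_tr_Jac// -rowE !mxE.
Qed.

Lemma derive_dot_gradient n (f : 'rV[R]_n -> R^o) x v :
  differentiable f x -> 'D_v f x = dot v (gradient f x).
Proof.
move=> df; rewrite deriveE// {1}(row_sum_delta v) linear_sum/=.
by apply: eq_bigr => i _; rewrite linearZ/= -deriveE// mxE.
Qed.

(** The formula grad V = (Jacobian of S)^T S in row form: write the squared norm as a sum of squares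
    of coordinates and apply the product rule. *)
Lemma gradient_half_norm2_sqr n q (f : 'rV[R]_n -> 'rV[R]_q) x :
  differentiable f x ->
  gradient (fun y => 2^-1 * norm2 (f y) ^+ 2 : R^o) x = f x *m Jac f x.
Proof.
move=> df; apply/rowP => k; rewrite !mxE.
have dfi i : differentiable (fun y => f y 0 i : R^o) x.
  by apply: (@differentiable_comp _ _ _ _ f (fun u : 'rV[R]_q => u 0 i)) => //;
    exact: differentiable_coord.
under [X in 'D__ X _]eq_fun do rewrite norm2_sqr.
rewrite (_ : (fun _ => _) = 2^-1 *:
    \sum_i ((fun y => f y 0 i : R^o) * (fun y => f y 0 i : R^o))); last first.
  by apply/funext => y; rewrite /= fctE fct_sumE.
have dM i : derivable ((fun y => f y 0 i : R^o) * (fun y => f y 0 i : R^o)) x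
    (delta_mx 0 k).
  by apply: derivableM; exact: diff_derivable.
rewrite deriveZ; last exact: derivable_sum.
rewrite derive_sum// scaler_sumr; apply: eq_bigr => i _.
rewrite deriveM; try exact: diff_derivable.
by rewrite JacE// /GRing.scale/=; field.
Qed.

End ContinuouslyDifferentiable.

(** * Derivatives relative to a domain *)

Section DerivativeWithin.
Context {R : realType} {V : normedModType R}.

(** The increment is [s - t] times the difference quotient, which converges. This gives continuity
    of a trajectory at time 0 too, where only a one-sided derivative is available. *)
Lemma has_derivative_within_cvg (D : set R) (z : R -> V) t l :
  has_derivative_within D z t l -> z s @[s --> within D (nbhs t)] --> z t.
Proof.
move=> zl.
have h : (s - t) *: ((s - t)^-1 *: (z s - z t)) @[s --> within D t^'] -->
    0 *: l.
  apply: cvgZ zl; apply: cvg_within_filter.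
  apply: (@cvg_within_filter _ _ _ (nbhs t)).
  have : (fun s : R^o => s - t) s @[s --> t] --> t - t.
    by apply: (@cvgB _ R^o); [exact: cvg_id|exact: cvg_cst].
  by rewrite subrr.
rewrite scale0r in h.
apply/cvgrPdist_lt => e e0; move/cvgrPdist_lt : h => /(_ _ e0) h.
have {}h : \forall s \near t, s != t -> D s ->
    `|0 - (s - t) *: ((s - t)^-1 *: (z s - z t))| < e by exact: h.
rewrite near_withinE; apply: filterS h => s hs Ds.
have [->|st] := eqVneq s t; first by rewrite subrr normr0.
by have := hs st Ds; rewrite scalerA mulfV ?subr_eq0// scale1r sub0r opprB.
Qed.

(** At an interior point of [D] the restriction to [D] disappears, and the translation s = t + h
    gives the usual derivative. *)
Lemma has_derivative_within_is_derive (D : set R) (z : R -> V) t l :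
  nbhs t D -> has_derivative_within D z t l -> is_derive t 1 z l.
Proof.
move=> tD zl.
have h : h^-1 *: (z (h *: 1 + t) - z t) @[h --> 0^'] --> l.
  apply/cvgrPdist_lt => e e0; move/cvgrPdist_lt : zl => /(_ _ e0) zl.
  have {}zl : \forall s \near t, s != t -> D s ->
      `|l - (s - t)^-1 *: (z s - z t)| < e by exact: zl.
  have : \forall s \near t, s != t -> `|l - (s - t)^-1 *: (z s - z t)| < e.
    by apply: filterS2 tD zl => s Ds h st; exact: h.
  move/nbhs0P => {}zl; apply: filterS zl => h.
  rewrite /= [h *: 1]mulr1 (addrC h) addrAC subrr add0r => zl h0; apply: zl.
  by rewrite -subr_eq0 addrAC subrr add0r.
by apply: DeriveDef; [apply/cvg_ex; exists l|exact: cvg_lim].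
Qed.

End DerivativeWithin.

(** * The rescaled gradient flow of half a squared norm, for a general map with injective
    Jacobian *)

Section GradientFlow.
Context {R : realType} {k l : nat}.
Variable S : 'rV[R]_l -> 'rV[R]_k.
Hypotheses (kl : k = l) (l_gt0 : (0 < l)%N).
Hypothesis C1S : forall i, times_cont_diff 1 (fun x => S x 0 i : R^o).
Hypothesis Jac_inj : forall y (v : 'rV[R]_l), v *m (Jac S y)^T = 0 -> v = 0.

Let W (y : 'rV[R]_l) : R^o := 2^-1 * norm2 (S y) ^+ 2.

Lemma C1_differentiable y : differentiable S y.
Proof. by apply: differentiable_rV => i; exact: (C1S i).1. Qed.

Lemma half_norm2_sqr_ge0 y : 0 <= W y.
Proof. by rewrite mulr_ge0// sqr_ge0. Qed.

Lemma half_norm2_sqr_eq0 y : W y = 0 -> S y = 0.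
Proof.
move=> /eqP; rewrite mulf_eq0 invr_eq0 pnatr_eq0/= norm2_sqr dot_eq0.
by move=> /eqP.
Qed.

Lemma half_norm2_sqr_differentiable y : differentiable W y.
Proof.
rewrite (_ : W = fun y => cst 2^-1 y * \sum_i S y 0 i * S y 0 i : R^o).
  have [] // := @C1M _ _ (cst 2^-1) (fun y => \sum_i S y 0 i * S y 0 i) _ _.
    exact: C1_cst.
  by apply: C1_sum => i; exact: C1M.
by apply/funext => x; rewrite /W norm2_sqr.
Qed.

Lemma half_norm2_sqr_continuous : continuous W.
Proof.
by move=> y; exact: differentiable_continuous (half_norm2_sqr_differentiable y).
Qed.

Lemma Jac_continuous i j : continuous (fun y => Jac S y i j).
Proof.
have [_ DS] := C1S i; move: (DS (delta_mx 0 j)).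
rewrite (_ : 'D__ _ = fun y => Jac S y i j)//.
by apply/funext => y; rewrite JacE//; exact: C1_differentiable.
Qed.

(* The minimum is taken of [|Jac S y v|^2] jointly in [y] and in the unit
   vector [v], so that no continuity of [sigma_min] is needed. *)
Lemma sigma_min_attained (K : set 'rV[R]_l) : compact K -> K !=set0 ->
  exists s, [/\ is_minimum [set sigma_min (Jac S y) | y in K] s, 0 < s &
    forall y v, K y ->
      s ^+ 2 * dot v v <= dot (v *m (Jac S y)^T) (v *m (Jac S y)^T)].
Proof.
move=> cK K0.
have cKS := compact_setX cK (@compact_unit_sphere R l).
have KS0 : K `*` @unit_sphere R l !=set0.
  by have [y Ky] := K0; have [v Sv] := @unit_sphere_nonempty R _ l_gt0;
    exists (y, v).
pose q (yv : 'rV[R]_l * 'rV[R]_l) :=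
  dot (yv.2 *m (Jac S yv.1)^T) (yv.2 *m (Jac S yv.1)^T).
have cv j : continuous (fun yv : 'rV[R]_l * 'rV[R]_l => yv.2 0 j).
  move=> yv; apply: (@continuous_comp _ _ _ snd (fun u : 'rV[R]_l => u 0 j)).
    exact: cvg_snd.
  exact: coord_continuous.
have cJ j i : continuous
    (fun yv : 'rV[R]_l * 'rV[R]_l => (Jac S yv.1)^T j i).
  under eq_fun do rewrite mxE.
  move=> yv; apply: (@continuous_comp _ _ _ fst (fun y => Jac S y i j)).
    exact: cvg_fst.
  exact: Jac_continuous.
have [|[y0 v0] yvK qmin] := compact_EVT_min KS0 cKS (f := q).
  by apply: continuous_subspaceT; apply: continuous_dot => i;
    under eq_fun do rewrite mxE; apply: continuous_sum => j yv;
    apply: continuousM; by [apply: cv|apply: cJ].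
move: yvK; rewrite inE => -[/= Ky0 Sv0].
have [s0_ge0 s0_le [u u1 uE]] := sigma_min_spec (Jac S y0) l_gt0.
(* The joint minimum is at least the squared [sigma_min] at [y0], because [v0] is a unit vector; it
   is also below every |Jac S y v|^2 with [y] in [K] and [v] a unit vector. *)
have smin y : K y -> sigma_min (Jac S y0) <= sigma_min (Jac S y).
  move=> Ky; apply: sigma_min_ge => // v v1.
  apply: le_trans (qmin (y, v) _); last by rewrite inE.
  by have := s0_le v0; rewrite Sv0 mulr1.
exists (sigma_min (Jac S y0)); split.
- by split; [exists y0|move=> _ [y Ky <-]; exact: smin].
(* If the minimum were 0, the unit vector [u] attaining it would lie in the kernel of the
   Jacobian. *)
- rewrite lt_neqAle s0_ge0 andbT; apply/eqP => s00.
  have : u *m (Jac S y0)^T = 0.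
    by apply/eqP; rewrite -dot_eq0 uE -s00 expr0n.
  by move/Jac_inj => u0; move/eqP: u1; rewrite u0 dot0l eq_sym oner_eq0.
- move=> y v Ky; have [s_ge0 /(_ v) le_s _] := sigma_min_spec (Jac S y) l_gt0.
  apply: le_trans le_s; have h := @lerXn2r _ 2 _ _ s0_ge0 s_ge0 (smin y Ky).
  exact: (ler_wpM2r (dot_ge0 v) h).
Qed.

Context {mu T : R} {z : R -> 'rV[R]_l}.
Hypotheses (mu_gt0 : 0 < mu) (T_gt0 : 0 < T) (flow : solution_flow W mu T z).

(** Chain rule along the flow, at interior times only: at 0 the derivative of [z] is one-sided. *)
Lemma flow_is_derive t : 0 < t < T -> is_derive t 1 (fun s => W (z s) : R^o)
  (- (mu / (T - t)) * dot (gradient W (z t)) (gradient W (z t))).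
Proof.
move=> /andP[t0 tT]; have t0T : 0 <= t < T by rewrite ltW.
have nt : nbhs t `[0, T[%classic.
  have : t \in `]0, T[ by rewrite in_itv/= t0.
  move/near_in_itvoo; apply: filterS; exact: subset_itv_oo_co.
have [dz zE] := has_derivative_within_is_derive nt (flow t0T).
have {}dz : differentiable z t by exact/derivable1_diffP.
have dW := half_norm2_sqr_differentiable (z t).
have dWz : differentiable (fun s => W (z s) : R^o) t.
  exact: (@differentiable_comp _ _ _ _ z).
apply: DeriveDef; first exact: diff_derivable.
rewrite deriveE// (@diff_comp _ _ _ _ z W)//= -[X in 'd W _ X]deriveE// zE.
by rewrite -deriveE// derive_dot_gradient// dotZl.
Qed.

Lemma flow_continuous : {within `[0, T[, continuous (fun s => W (z s) : R^o)}.
Proof.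
apply/subspace_continuousP => t /=; rewrite in_itv/= => t0T.
apply: cvg_comp (has_derivative_within_cvg (flow t0T)) _.
exact: half_norm2_sqr_continuous.
Qed.

Lemma flow_nonincreasing t : 0 <= t < T -> W (z t) <= W (z 0).
Proof.
move=> /andP[t0 tT].
apply: (@ler0_derive1_le_co R (fun s => W (z s) : R^o) 0 T) => //.
- by move=> s; rewrite in_itv/= => /flow_is_derive[].
- move=> s; rewrite in_itv/= => sT; rewrite derive1E.
  have [_ ->] := flow_is_derive sT; case/andP: sT => _ sT.
  by rewrite mulNr oppr_le0 mulr_ge0 ?dot_ge0// divr_ge0 ?subr_ge0 ?ltW.
- exact: flow_continuous.
- by rewrite in_itv/= t0.
- by rewrite in_itv/= lexx.
Qed.

(** A Polyak-Lojasiewicz inequality. The gradient applies the transposed Jacobian to [S y], so the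
    bound on the Jacobian is first transferred to its transpose, which uses that it is square. *)
Lemma gradient_lower_bound (s : R) y : 0 < s ->
  (forall v, s ^+ 2 * dot v v <= dot (v *m (Jac S y)^T) (v *m (Jac S y)^T)) ->
  2 * s ^+ 2 * W y <= dot (gradient W y) (gradient W y).
Proof.
move=> s0 le_s; rewrite gradient_half_norm2_sqr; last exact: C1_differentiable.
have := transpose_lower_bound kl (exprn_gt0 2 s0) le_s (S y).
apply: le_trans; rewrite /W norm2_sqr.
by rewrite le_eqVlt; apply/orP; left; apply/eqP; field.
Qed.

(** * Gronwall argument giving the explicit decay rate *)

Section Decay.
Context {s : R}.
Hypothesis s_gt0 : 0 < s.
Hypothesis s_lb : forall y, W y <= W (z 0) -> forall v,
  s ^+ 2 * dot v v <= dot (v *m (Jac S y)^T) (v *m (Jac S y)^T).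
Let gam := 2 * s ^+ 2 * mu.

Lemma weight_is_derive t : t < T ->
  is_derive t 1 (fun r => (T - r) `^ (- gam))
    (gam / (T - t) * (T - t) `^ (- gam)).
Proof.
move=> tT; have Tt : 0 < T - t by rewrite subr_gt0.
have d1 : is_derive t 1 (fun r : R => T - r) (- 1).
  by rewrite -[X in is_derive _ _ _ X]sub0r; apply: is_deriveB.
have h := @is_derive1_comp R (fun u => u `^ (- gam)) (fun r => T - r) t _ _
  (is_derive1_powR (- gam) Tt) d1.
apply: is_derive_eq h _.
rewrite powRB ?powRr1 ?ltW//; last by rewrite (gt_eqF Tt) implybT.
by field; rewrite gt_eqF.
Qed.

(** The weight (T - r)^(- gam) is the integrating factor of w' = - gam w / (T - r), so its product
    with [W (z r)] is nonincreasing. *)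
Lemma flow_decay t : 0 <= t < T -> W (z t) <= W (z 0) * ((T - t) / T) `^ gam.
Proof.
move=> /andP[t0 tT].
pose p (r : R) : R^o := (T - r) `^ (- gam).
have dp (r : R) : r < T -> is_derive r 1 p (gam / (T - r) * p r).
  exact: weight_is_derive.
have : W (z t) * p t <= W (z 0) * p 0.
  apply: (@ler0_derive1_le_co R (fun r => W (z r) * p r : R^o) 0 T) => //.
  - move=> r; rewrite in_itv/= => rT.
    have [dW _] := flow_is_derive rT; case/andP: rT => _ /dp[dpr _].
    exact: derivableM.
  - move=> r; rewrite in_itv/= => rT; rewrite derive1E.
    have [dW WE] := flow_is_derive rT; case/andP: (rT) => r0 rT'.
    have [dpr pE] := dp _ rT'.
    rewrite deriveM// WE pE.
    have rT0 : 0 <= r < T by rewrite ltW.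
    have Tr : 0 < T - r by rewrite subr_gt0.
    (* Monotonicity of [W] along the flow keeps [z r] in the initial sublevel set, the only place
       where [s_lb] holds. *)
    have := gradient_lower_bound s_gt0 (s_lb (flow_nonincreasing rT0)).
    rewrite /GRing.scale/=; set G := dot _ _; set w := W (z r) => wG.
    have -> : w * (gam / (T - r) * p r) + p r * (- (mu / (T - r)) * G)
        = - (p r * mu / (T - r) * (G - 2 * s ^+ 2 * w)).
      by rewrite /gam; field; rewrite gt_eqF.
    rewrite oppr_le0 mulr_ge0 ?subr_ge0// divr_ge0 ?(ltW Tr)//.
    by rewrite mulr_ge0 ?(ltW mu_gt0)// powR_ge0.
  - apply/subspace_continuousP => r; rewrite /= in_itv/= => rT.
    apply: cvgM.
      by move/subspace_continuousP : flow_continuous; apply; rewrite /= in_itv.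
    apply: cvg_within_filter; have [dpr _] := dp r (andP rT).2.
    by apply: differentiable_continuous; exact/derivable1_diffP.
  - by rewrite in_itv/= t0.
  - by rewrite in_itv/= lexx.
have Tt : 0 < T - t by rewrite subr_gt0.
(* Here [p 0] is T^(- gam); dividing by [p t] produces the ratio ((T - t) / T)^gam. *)
rewrite /p subr0 !powRN ler_pdivrMr ?powR_gt0// => /le_trans; apply.
rewrite powRM ?invr_ge0 ?(ltW Tt) ?(ltW T_gt0)//.
rewrite -[T^-1]powR_inv1 ?(ltW T_gt0)// -powRrM mulN1r powRN.
by rewrite mulrAC mulrA.
Qed.

Lemma flow_cvg0 : W (z t) @[t --> T^'-] --> (0 : R^o).
Proof.
have gam_gt0 : 0 < gam by rewrite !mulr_gt0// exprn_gt0.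
have h : (W (z 0) * ((T - t) / T) `^ gam : R^o) @[t --> T^'-] --> (0 : R^o).
  rewrite -[X in _ --> (X : R^o)](mulr0 (W (z 0))).
  apply: cvgM; first exact: cvg_cst.
  (* Powers tend to 0 along the right neighbourhoods of 0, so the ratio must be shown to stay
     positive as well as to vanish. *)
  apply: (@cvg_comp _ _ _ (fun t => (T - t) / T) (fun u => u `^ gam) _ 0^'+);
    last exact: powR_cvg0.
  have Tt : (fun t => (T - t) / T) @ T^'- --> (0 : R).
    apply: cvg_at_left_filter.
    have : (fun t : R^o => (T - t) / T) t @[t --> T] --> (T - T) / T.
      apply: cvgM; last exact: cvg_cst.
      by apply: (@cvgB _ R^o); [exact: cvg_cst|exact: cvg_id].
    by rewrite subrr mul0r.
  move=> P /= /Tt /= h; near=> t; have : 0 < (T - t) / T; last by near: t.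
  by rewrite divr_gt0// subr_gt0; near: t; exact: nbhs_left_lt.
apply: (squeeze_cvgr _ (@cvg_cst _ _ _ _ _) h).
near=> t; rewrite half_norm2_sqr_ge0/= flow_decay//; apply/andP; split.
  by near: t; exact: nbhs_left_ge.
by near: t; exact: nbhs_left_lt.
Unshelve. all: by end_near. Qed.

End Decay.

(** Decay of [W] makes every cluster point of the trajectory a zero of [S]; with a unique zero and a
    compact set, the trajectory converges. The strict inequality [W (z 0) < c] matters: even if
    [W (z 0)] is 0, the compact set is then a neighbourhood of the zero. *)
Lemma gradient_flow_converges c : W (z 0) < c ->
  compact [set y | W y <= c] ->
  (forall x y, S x = 0 -> S y = 0 -> x = y) ->
  [/\ forall t, 0 <= t < T -> W (z t) <= W (z 0),
      exists s, [/\ is_minimum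
          [set sigma_min (Jac S y) | y in [set y | W y <= W (z 0)]] s,
        0 < s & forall t, 0 <= t < T ->
          W (z t) <= W (z 0) * ((T - t) / T) `^ (2 * s ^+ 2 * mu)] &
      W (z t) @[t --> T^'-] --> (0 : R^o) /\
      exists zs, [/\ S zs = 0, forall y, S y = 0 -> y = zs &
                     z t @[t --> T^'-] --> zs]].
Proof.
move=> Wc cK zero_uniq.
have cK0 : compact [set y | W y <= W (z 0)].
  apply: subclosed_compact cK _; last first.
    by move=> y /= /le_trans; apply; exact: ltW.
  apply: (@closed_comp _ _ W [set x | x <= W (z 0)]); last exact: closed_le.
  by move=> y _; exact: half_norm2_sqr_continuous.
have K0 : [set y | W y <= W (z 0)] !=set0 by exists (z 0) => /=.
have [s [s_min s_gt0 s_lb]] := sigma_min_attained cK0 K0.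
have s_lb' y : W y <= W (z 0) -> forall v,
    s ^+ 2 * dot v v <= dot (v *m (Jac S y)^T) (v *m (Jac S y)^T).
  by move=> Ky v; exact: s_lb.
have W0 := flow_cvg0 s_gt0 s_lb'.
split; first exact: flow_nonincreasing.
  by exists s; split=> //; exact: flow_decay.
split=> //.
have zK : (z @ T^'-) [set y | W y <= c].
  rewrite /= /fmap/=; near=> t; apply: le_trans (ltW Wc).
  apply: flow_nonincreasing; apply/andP; split.
    by near: t; exact: nbhs_left_ge.
  by near: t; exact: nbhs_left_lt.
(* By continuity, [W y] is a cluster point of [W] along the trajectory, whose limit is 0; limits in
   a Hausdorff space have no other cluster point. *)
have clusterS y : cluster (z @ T^'-) y -> S y = 0.
  move=> zy; apply: half_norm2_sqr_eq0; apply/esym.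
  apply: (@norm_hausdorff _ R^o); apply: (cvg_cluster W0).
  move=> P Q WP Qy.
  have [x [Px Qx]] :=
    zy (W @^-1` P) (W @^-1` Q) WP (half_norm2_sqr_continuous Qy).
  by exists (W x).
have [zs [_ zs_cl]] := cK (z @ T^'-) _ zK.
exists zs; split; [exact: clusterS| |].
  by move=> y Sy; apply: zero_uniq => //; exact: clusterS.
(* A filter containing a compact neighbourhood of its only cluster point converges to that point. *)
apply: (@compact_cluster_set1 _ zs _ [set y | W y <= c]) => //.
- have Wzs : W zs = 0 by rewrite /W norm2_sqr (clusterS _ zs_cl) dot0l mulr0.
  have : \forall x \near zs, W x < c.
    have cl : W zs < c.
      by rewrite Wzs; apply: le_lt_trans Wc; exact: half_norm2_sqr_ge0.
    exact: (@half_norm2_sqr_continuous zs _ (lt_nbhsl cl)).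
  by apply: filterS => x /= /ltW.
- apply/seteqP; split=> [y /clusterS Sy|y ->//] /=.
  by apply: zero_uniq => //; exact: clusterS.
Unshelve. all: by end_near. Qed.

End GradientFlow.

(** * Infinitesimal monotonicity and convexity *)

Section MonotoneMaps.
Context {R : realType}.

(** Apply monotonicity to x + h a and x, divide by h^2 and let h tend to 0. The constant [c] has no
    sign condition: it is positive for the pseudo-gradient and 0 for gradients of convex
    constraints. *)
Lemma monotone_derive n (G : 'rV[R]_n -> 'rV[R]_n) (c : R) x a :
  (forall x y, c * norm2 (x - y) ^+ 2 <= dot (G x - G y) (x - y)) ->
  derivable G x a -> c * dot a a <= dot ('D_a G x) a.
Proof.
move=> Gmono dG.
have dota : {for 'D_a G x, continuous (fun u : 'rV[R]_n => dot u a)}.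
  move: ('D_a G x); apply: continuous_dot => i u; first exact: coord_continuous.
  exact: cst_continuous.
have lima : dot (h^-1 *: (G (h *: a + x) - G x)) a @[h --> 0^'] -->
    dot ('D_a G x) a.
  exact: (@cvg_comp _ _ _ (fun h : R => h^-1 *: (G (h *: a + x) - G x))
    (fun u : 'rV[R]_n => dot u a) _ _ _ dG dota).
rewrite -(cvg_lim _ lima)//; apply: limr_ge.
  by apply/cvg_ex; eexists; exact: lima.
near=> h.
have h0 : h != 0 by near: h; exact: nbhs_dnbhs_neq.
have := Gmono (h *: a + x) x; rewrite addrK norm2_sqr !(dotZl, dotZr) => Gh.
rewrite -(@ler_pM2l _ (h ^+ 2)) ?exprn_even_gt0//.
have -> : h ^+ 2 * (c * dot a a) = c * (h * (h * dot a a)) by ring.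
by apply: le_trans Gh _; rewrite expr2 mulrA mulfK.
Unshelve. all: by end_near. Qed.

(** Convexity bounds the forward difference quotient by [f y - f x] for 0 < h <= 1; the one-sided
    limit keeps the bound. *)
Lemma convex_gradient_ineq n (f : 'rV[R]_n -> R^o) x y :
  convex_function setT f -> differentiable f x -> 'D_(y - x) f x <= f y - f x.
Proof.
move=> fconv df.
have lim0 : h^-1 *: (f (h *: (y - x) + x) - f x) @[h --> 0^'+] -->
    'D_(y - x) f x.
  by apply: cvg_dnbhs_at_right; exact: diff_derivable.
rewrite -(cvg_lim _ lim0)//; apply: limr_le.
  by apply/cvg_ex; eexists; exact: lim0.
near=> h.
have h0 : 0 < h by near: h; exact: nbhs_right_gt.
have h1 : h <= 1 by near: h; exact: nbhs_right_le.
have : f (h *: y + (1 - h) *: x) <= h * f y + (1 - h) * f x.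
  by apply: (fconv (Itv01 (ltW h0) h1)); rewrite inE.
rewrite (_ : _ + _ *: x = h *: (y - x) + x); last first.
  by rewrite scalerBl scalerBr scale1r addrA addrAC.
move=> fh; rewrite [_ *: _]/(_ * _) ler_pdivrMl// lerBlDr.
by apply: le_trans fh _; rewrite le_eqVlt; apply/orP; left; apply/eqP; ring.
Unshelve. all: by end_near. Qed.

Lemma convex_gradient_monotone n (f : 'rV[R]_n -> R^o) x y :
  convex_function setT f -> (forall x, differentiable f x) ->
  0 <= dot (gradient f x - gradient f y) (x - y).
Proof.
move=> fconv df.
have h1 := convex_gradient_ineq x fconv (df y).
have h2 := convex_gradient_ineq y fconv (df x).
rewrite !derive_dot_gradient// in h1 h2.
rewrite dotBl (dotC (gradient f x)) (dotC (gradient f y)).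
have := lerD h1 h2.
have -> : y - x = - (x - y) by rewrite opprB.
by rewrite dotNl; lra.
Qed.

End MonotoneMaps.

(** * Derivative rules for scalar functions, with explicit values *)

Section ScalarDerivatives.
Context {R : realType} {V : normedModType R}.

Lemma is_derive_sum_fun n (h : 'I_n -> V -> R^o) (dh : 'I_n -> R) x v :
  (forall i, is_derive x v (h i) (dh i)) ->
  is_derive x v (fun y => \sum_i h i y : R^o) (\sum_i dh i).
Proof.
move=> dhi; rewrite (_ : (fun _ => _) = \sum_i h i); first exact: is_derive_sum.
by apply/funext => y; rewrite fct_sumE.
Qed.

Lemma is_derive_sqrt_fun (f : V -> R^o) x v df :
  differentiable f x -> 0 < f x ->
  is_derive x v f df ->
  is_derive x v (fun y => Num.sqrt (f y) : R^o) ((2 * Num.sqrt (f x))^-1 * df).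
Proof.
move=> dfx f0 [_ <-]; rewrite -derive_sqrt//; apply: DeriveDef => //.
apply: diff_derivable; apply: (@differentiable_comp _ _ _ _ f) => //.
by apply/derivable1_diffP; have [] := is_derive1_sqrt f0.
Qed.

Lemma is_derive_comp_linear {W : normedModType R} (f : W -> R^o)
    (L : {linear V -> W}) x v :
  continuous L -> differentiable f (L x) ->
  is_derive x v (fun y => f (L y) : R^o) ('D_(L v) f (L x)).
Proof.
move=> cL df; rewrite -derive_comp_linear//; apply: DeriveDef => //.
apply: diff_derivable; apply: (@differentiable_comp _ _ _ _ L) => //.
exact: linear_differentiable.
Qed.

End ScalarDerivatives.

Lemma is_derive_coord {R : realType} n (x v : 'rV[R]_n) i :
  is_derive x v (fun y : 'rV[R]_n => y 0 i : R^o) (v 0 i).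
Proof.
apply: DeriveDef; last by rewrite derive_coord// derive_id.
by apply: diff_derivable; exact: differentiable_coord.
Qed.

(** * Zeros of the perturbed Fischer-Burmeister function *)

Section SqrtSumSquares.
Context {R : rcfType}.
Implicit Types a b e : R.

Lemma sqrt_gt_summand a q : a ^+ 2 < q -> a < Num.sqrt q.
Proof.
move=> aq; apply: le_lt_trans (ler_norm a) _; rewrite -sqrtr_sqr ltr_sqrt//.
by apply: le_lt_trans aq; exact: sqr_ge0.
Qed.

(** The root equals a + b and exceeds a, whence b > 0; squaring cancels a^2 + b^2 and leaves the
    hyperbola. *)
Lemma perturbed_FischerBurmeister_eq0 a b e : 0 < e ->
  Num.sqrt (a ^+ 2 + b ^+ 2 + e ^+ 2) - (a + b) = 0 ->
  0 < b /\ 2 * (a * b) = e ^+ 2.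
Proof.
move=> e0 /eqP; rewrite subr_eq0 => /eqP sE.
have e2 : 0 < e ^+ 2 by rewrite exprn_gt0.
have b0 : 0 < b.
  have : a < a + b.
    by rewrite -sE; apply: sqrt_gt_summand; have := sqr_ge0 b; lra.
  by lra.
split=> //; have := @sqr_sqrtr _ (a ^+ 2 + b ^+ 2 + e ^+ 2).
rewrite sE; have := sqr_ge0 a; have := sqr_ge0 b => b2 a2 /(_ _).
move=> h; have {}h := h (addr_ge0 (addr_ge0 a2 b2) (ltW e2)).
by rewrite sqrrD in h; lra.
Qed.

End SqrtSumSquares.


(** * The stationarity map: smoothness, injective Jacobian, unique zero *)

Section Stationarity.
Context {R : realType} {n p m : nat}.
Variables (F : 'rV[R]_n -> 'rV[R]_n) (g : 'rV[R]_n -> 'rV[R]_p).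
Variables (A : 'M[R]_(m, n)) (b : 'rV[R]_m) (eps : R).
Hypothesis eps_gt0 : 0 < eps.
Hypothesis C1F : forall k, times_cont_diff 1 (fun x => F x 0 k : R^o).
Hypothesis F_mono : strongly_monotone F.
Hypothesis C2g : times_cont_diff 2 g.
Hypothesis g_convex : forall j, convex_function setT (fun x => g x 0 j).
Hypothesis A_free : row_free A.

Notation S := (Smap F g A b eps).
Notation Z := 'rV[R]_(n + p + m).
Notation px z := (lsubmx (lsubmx z)).
Notation lam z j := (z 0 (lshift m (rshift n j))).
Notation mu z i := (z 0 (rshift (n + p) i)).
Let gj j (x : 'rV[R]_n) : R^o := g x 0 j.
Let ltilde (l : R) : R := 2^-1 * (Num.sqrt (l ^+ 2 + eps ^+ 2) + l).

(** Together with [eqc] and [comp], the scalar coordinates of the three blocks of [S], to which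
    real-valued differentiation rules apply. *)
Let stat k (z : Z) : R^o :=
  F (px z) 0 k + \sum_j ltilde (lam z j) * gradient (gj j) (px z) 0 k +
  \sum_i mu z i * A i k.
Let eqc i (z : Z) : R^o := \sum_k px z 0 k * A i k - b 0 i.
Let q j (z : Z) : R^o :=
  lam z j ^+ 2 + (- gj j (px z)) ^+ 2 + eps ^+ 2.
Let comp j (z : Z) : R^o :=
  Num.sqrt (q j z) - (lam z j + - gj j (px z)).

Let C1gj j : times_cont_diff 1 (gj j).
Proof. by apply: times_cont_diffS; exact: times_cont_diff_coord. Qed.

Let gj_diff j x : differentiable (gj j) x.
Proof. exact: (C1gj j).1. Qed.

Let g_diff x : differentiable g x.
Proof. exact: C2g.1. Qed.

Let C1grad j k : times_cont_diff 1 (fun x => gradient (gj j) x 0 k : R^o).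
Proof.
have [_ /(_ (delta_mx 0 k))] := times_cont_diff_coord j C2g.
by congr (times_cont_diff 1 _); apply/funext => x; rewrite mxE.
Qed.

Lemma Smap_stat k : (fun z => S z 0 (lshift p (lshift m k)) : R^o) = stat k.
Proof.
apply/funext => z; rewrite /Smap row_mxEl row_mxEl mxE.
congr (_ + _); last first.
  by rewrite mxE; apply: eq_bigr => i _; congr (_ * _); rewrite mxE.
rewrite mxE; congr (_ + _); rewrite mxE; apply: eq_bigr => j _; congr (_ * _).
  by rewrite !mxE.
by rewrite JacE// mxE.
Qed.

Lemma Smap_eqc i : (fun z => S z 0 (lshift p (rshift n i)) : R^o) = eqc i.
Proof.
apply/funext => z; rewrite /Smap row_mxEl row_mxEr mxE; congr (_ + _).
  by rewrite mxE; apply: eq_bigr => k _; congr (_ * _); rewrite mxE.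
by rewrite mxE.
Qed.

Lemma Smap_comp j : (fun z => S z 0 (rshift (n + m) j) : R^o) = comp j.
Proof. by apply/funext => z; rewrite /Smap row_mxEr !mxE. Qed.

Let px_continuous : continuous
  ((lsubmx \o lsubmx) : Z -> 'rV[R]_n).
Proof.
by move=> z; apply: continuous_comp; exact: continuous_lsubmx.
Qed.

Let C1px (f : 'rV[R]_n -> R^o) : times_cont_diff 1 f ->
  times_cont_diff 1 (fun z : Z => f (px z) : R^o).
Proof. exact: (C1_comp_linear px_continuous). Qed.

Let C1lam j : times_cont_diff 1 (fun z : Z => lam z j : R^o).
Proof. exact: C1_coord. Qed.

Let qlt j (z : Z) : R^o := lam z j ^+ 2 + eps ^+ 2.

Let qlt_gt0 j z : 0 < qlt j z.
Proof.
by rewrite /qlt; have := sqr_ge0 (lam z j); have := exprn_gt0 2 eps_gt0; lra.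
Qed.

Let C1qlt j : times_cont_diff 1 (qlt j).
Proof. by rewrite /qlt; apply: C1D; [apply: C1M|exact: C1_cst]. Qed.

Let q_gt0 j z : 0 < q j z.
Proof.
rewrite /q; have := sqr_ge0 (lam z j); have := sqr_ge0 (- gj j (px z)).
by have := exprn_gt0 2 eps_gt0; lra.
Qed.

Let C1q j : times_cont_diff 1 (q j).
Proof.
rewrite /q; apply: C1D; last exact: C1_cst.
apply: C1D; first by apply: C1M; exact: C1lam.
by apply: C1M; apply: C1N; apply: C1px; exact: C1gj.
Qed.

(** The first block contains gradients of g, hence the second order assumption on [g]; [eps] > 0
    keeps both radicands positive. *)
Lemma C1_Smap i : times_cont_diff 1 (fun z => S z 0 i : R^o).
Proof.
case: (split_ordP i) => [i' ->|j ->]; last first.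
  rewrite Smap_comp; apply: C1B; first exact: C1_sqrt.
  by apply: C1D; [exact: C1lam|apply: C1N; apply: C1px; exact: C1gj].
case: (split_ordP i') => [k ->|l ->].
  rewrite Smap_stat; apply: C1D; last first.
    by apply: C1_sum => r; apply: C1M; [exact: C1_coord|exact: C1_cst].
  apply: C1D; first exact: (C1px (f := fun x => F x 0 k)).
  apply: C1_sum => j; apply: C1M; last first.
    exact: (C1px (f := fun x => gradient (gj j) x 0 k)).
  apply: C1M; first exact: C1_cst.
  by apply: C1D; [exact: (C1_sqrt (C1qlt j))|exact: C1lam].
rewrite Smap_eqc; apply: C1B; last exact: C1_cst.
apply: C1_sum => k; apply: C1M; last exact: C1_cst.
by apply: (C1px (f := fun x => x 0 k)); exact: C1_coord.
Qed.

(** The derivative of [ltilde] at the multiplier [lam z j]. *)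
Let kap j (z : Z) : R :=
  2^-1 * (lam z j / Num.sqrt (qlt j z) + 1).

Let ltilde_gt0 (l : R) : 0 < ltilde l.
Proof.
rewrite /ltilde mulr_gt0// -ltrBlDr sub0r; apply: sqrt_gt_summand.
by rewrite sqrrN ltrDl exprn_gt0.
Qed.

Let kap_gt0 j z : 0 < kap j z.
Proof.
have r0 : 0 < Num.sqrt (qlt j z) by rewrite sqrtr_gt0.
rewrite /kap mulr_gt0// -ltrBlDr sub0r ltr_pdivlMr// mulN1r ltrNl.
by apply: sqrt_gt_summand; rewrite sqrrN ltrDl exprn_gt0.
Qed.

Lemma is_derive_lambda_tilde j z v : is_derive z v
  (fun z : Z => ltilde (lam z j) : R^o) (kap j z * lam v j).
Proof.
have dl := is_derive_coord z v (lshift m (rshift n j)).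
have dq : is_derive z v (qlt j) (lam z j *: lam v j + lam z j *: lam v j + 0).
  exact: is_deriveD (is_deriveM dl dl) (is_derive_cst (eps ^+ 2 : R^o) z v).
have ds := is_derive_sqrt_fun ((C1qlt j).1 z) (qlt_gt0 j z) dq.
have := is_deriveZ 2^-1 (is_deriveD ds dl).
move=> h; apply: is_derive_eq h _.
rewrite /kap /GRing.scale/=.
have r0 : 0 < Num.sqrt (qlt j z) by rewrite sqrtr_gt0.
by field; rewrite gt_eqF.
Qed.

Let is_derive_px (f : 'rV[R]_n -> R^o) (z v : Z) :
  differentiable f (px z) ->
  is_derive z v (fun z => f (px z) : R^o) ('D_(px v) f (px z)).
Proof. exact: (is_derive_comp_linear v px_continuous). Qed.

Lemma is_derive_stat k z v : is_derive z v (stat k)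
  ('D_(px v) (fun x => F x 0 k : R^o) (px z) +
   \sum_j (ltilde (lam z j) *
             'D_(px v) (fun x => gradient (gj j) x 0 k : R^o) (px z) +
           gradient (gj j) (px z) 0 k * (kap j z * lam v j)) +
   \sum_i mu v i * A i k).
Proof.
apply: (@is_deriveD _ _ _
  (fun z : Z => F (px z) 0 k +
     \sum_j ltilde (lam z j) * gradient (gj j) (px z) 0 k : R^o)
  (fun z : Z => \sum_i mu z i * A i k : R^o)).
  apply: (@is_deriveD _ _ _ (fun z : Z => F (px z) 0 k : R^o)).
    exact: (is_derive_px v ((C1F k).1 _)).
  apply: is_derive_sum_fun => j.
  have := @is_deriveM _ _ (fun z : Z => ltilde (lam z j))
    (fun z : Z => gradient (gj j) (px z) 0 k) z v _ _
    (is_derive_lambda_tilde j z v)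
    (is_derive_px v ((C1grad j k).1 _)).
  by move=> h; apply: is_derive_eq h _.
apply: is_derive_sum_fun => i.
have := @is_deriveM _ _ (fun z : Z => mu z i) (cst (A i k)) z v _ _
  (is_derive_coord z v _) (is_derive_cst _ _ _).
by move=> h; apply: is_derive_eq h _; rewrite scaler0 add0r mulrC.
Qed.

Lemma is_derive_eqc i z v : is_derive z v (eqc i) (\sum_k px v 0 k * A i k).
Proof.
rewrite -[X in is_derive _ _ _ X]subr0.
apply: (@is_deriveB _ _ _
  (fun z : Z => \sum_k px z 0 k * A i k : R^o) (cst (b 0 i))).
apply: is_derive_sum_fun => k.
have dx := is_derive_px v (differentiable_coord (px z) 0 k).
have := @is_deriveM _ _ _ (cst (A i k)) z v _ _ dx (is_derive_cst _ _ _).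
move=> h; apply: is_derive_eq h _; rewrite scaler0 add0r mulrC.
by rewrite derive_coord// derive_id.
Qed.

Lemma is_derive_comp j z v : is_derive z v (comp j)
  ((2 * Num.sqrt (q j z))^-1 *
   (2 * lam z j * lam v j + 2 * gj j (px z) * 'D_(px v) (gj j) (px z)) -
   (lam v j - 'D_(px v) (gj j) (px z))).
Proof.
have dl := is_derive_coord z v (lshift m (rshift n j)).
have dg := is_deriveN (is_derive_px v (gj_diff j (px z))).
have dq := is_deriveD (is_deriveD (is_deriveM dl dl) (is_deriveM dg dg))
  (is_derive_cst (eps ^+ 2 : R^o) z v).
have ds := is_derive_sqrt_fun ((C1q j).1 z) (q_gt0 j z) dq.
have h := is_deriveB ds (is_deriveD dl dg).
apply: is_derive_eq h _; rewrite /GRing.scale/= opprfctE.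
by congr (_ * _ - _); ring.
Qed.

Let F_diff x : differentiable F x.
Proof. by apply: differentiable_rV => k; exact: (C1F k).1. Qed.

Let grad_diff j x : differentiable (gradient (gj j)) x.
Proof. by apply: differentiable_rV => k; exact: (C1grad j k).1. Qed.

Lemma Smap_Jac_inj z (v : Z) : v *m (Jac S z)^T = 0 -> v = 0.
Proof.
have S_diff : differentiable S z.
  by apply: differentiable_rV => i; exact: (C1_Smap i).1.
rewrite mulmx_tr_Jac// => DS0.
have D0 i : 'D_v (fun z => S z 0 i : R^o) z = 0.
  by rewrite derive_coord// DS0 mxE.
set x := px z; set a := px v.
set u := rsubmx v; pose G j := 'D_a (gj j) x.
have aA : a *m A^T = 0.
  apply/rowP => i; rewrite mxE [RHS]mxE.
  have := D0 (lshift p (rshift n i)); rewrite Smap_eqc.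
  have [_ ->] := is_derive_eqc i z v => h; rewrite -[RHS]h.
  by apply: eq_bigr => k _; rewrite [A^T _ _]mxE.
(* With r the root in [comp], clearing denominators in the derivative gives l_j (r - lambda_j) = G_j
   (r + g_j). Both factors are positive because r exceeds |lambda_j| and |g_j|. *)
have lG j : exists2 w, 0 < w & exists2 w', 0 < w' & lam v j * w = G j * w'.
  have := D0 (rshift (n + m) j); rewrite Smap_comp.
  have [_ ->] := is_derive_comp j z v; rewrite -/x -/a -/(G j).
  have r0 : 0 < Num.sqrt (q j z) by rewrite sqrtr_gt0.
  have rl : lam z j < Num.sqrt (q j z).
    apply: sqrt_gt_summand; rewrite /q; have := sqr_ge0 (- gj j (px z)).
    by have := exprn_gt0 2 eps_gt0; lra.
  have rg : - gj j x < Num.sqrt (q j z).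
    apply: sqrt_gt_summand; rewrite /q; have := sqr_ge0 (lam z j).
    by have := exprn_gt0 2 eps_gt0; rewrite -/x; lra.
  set r := Num.sqrt _ in r0 rl rg * => h.
  exists (r - lam z j); first by rewrite subr_gt0.
  exists (r + gj j x); first by lra.
  apply/eqP; rewrite -subr_eq0; apply/eqP.
  rewrite -[RHS](mulr0 (- r)) -h; field; rewrite gt_eqF//.
have stat0 : 'D_a F x + \sum_j (ltilde (lam z j) *: 'D_a (gradient (gj j)) x +
    (kap j z * lam v j) *: gradient (gj j) x) + u *m A = 0.
  apply/rowP => k; rewrite [RHS]mxE.
  have := D0 (lshift p (lshift m k)); rewrite Smap_stat.
  have [_ ->] := is_derive_stat k z v => h; rewrite -[RHS]h.
  rewrite mxE [X in X + _]mxE summxE -!derive_coord//; congr (_ + _ + _).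
    apply: eq_bigr => j _; rewrite mxE [X in X + _]mxE [X in _ + X]mxE.
    by rewrite -derive_coord// [X in _ + X]mulrC.
  by rewrite mxE; apply: eq_bigr => i _; rewrite [u _ _]mxE.
have [c c_gt0 Fc] := F_mono.
(* Pairing with [a] removes the multiplier term, since A a = 0. The Hessian terms are nonnegative by
   convexity, and the terms kap_j l_j G_j because l_j and G_j have the same sign. *)
have a0 : a = 0.
  have := congr1 (fun w => dot w a) stat0.
  rewrite dot0l !dotDl dot_suml dot_mulmxl aA [dot u 0]dotC dot0l addr0 => h.
  have hF : c * dot a a <= dot ('D_a F x) a.
    by apply: monotone_derive => //; exact: diff_derivable.
  apply/eqP; rewrite -dot_eq0 eq_le dot_ge0 andbT -(pmulr_rle0 _ c_gt0).
  apply: le_trans hF _; rewrite -h lerDl; apply: sumr_ge0 => j _.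
  rewrite dotDl !dotZl addr_ge0//.
    rewrite mulr_ge0 ?(ltW (ltilde_gt0 _))//.
    have := @monotone_derive _ _ (gradient (gj j)) 0 x a; rewrite mul0r; apply.
      by move=> y y'; rewrite mul0r;
        exact: convex_gradient_monotone (@g_convex j) (gj_diff j).
    exact: diff_derivable.
  rewrite dotC -derive_dot_gradient// -/(G j) -mulrA.
  rewrite mulr_ge0 ?(ltW (kap_gt0 _ _))//.
  have [w w0 [w' w'0 e]] := lG j.
  rewrite -(pmulr_lge0 _ w0) mulrAC e mulrAC.
  by rewrite mulr_ge0 ?(ltW w'0)// -expr2 sqr_ge0.
have l0 j : lam v j = 0.
  have [w w0 [w' w'0]] := lG j; rewrite /G a0 derive0 mul0r => /eqP.
  by rewrite mulf_eq0 (gt_eqF w0) orbF => /eqP.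
(* With a = 0 and l = 0 the stationarity rows reduce to A^T u = 0, and A has full row rank. *)
have u0 : u = 0.
  apply: (row_free_inj A_free); rewrite mul0mx -stat0 a0 derive0 add0r.
  rewrite big1 ?add0r// => j _.
  by rewrite derive0 l0 mulr0 scaler0 scale0r addr0.
rewrite -[v]hsubmxK -[lsubmx v]hsubmxK -/a a0 -/u u0.
rewrite (_ : rsubmx (lsubmx v) = 0) ?row_mx0//.
by apply/rowP => j; rewrite !mxE l0.
Qed.

Let Smap_stat_vec z : S z = 0 ->
  F (px z) + \sum_j ltilde (lam z j) *: gradient (gj j) (px z) +
    rsubmx z *m A = 0.
Proof.
move=> Sz; apply/rowP => k; rewrite [RHS]mxE.
have := congr1 (@^~ z) (Smap_stat k); rewrite /= Sz mxE => h.
rewrite [RHS]h mxE [X in X + _]mxE summxE; congr (_ + _ + _).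
  by apply: eq_bigr => j _; rewrite mxE.
by rewrite mxE; apply: eq_bigr => i _; rewrite [rsubmx _ _ _]mxE.
Qed.

Let Smap_eqc_vec z : S z = 0 -> px z *m A^T = b.
Proof.
move=> Sz; apply/rowP => i; apply/eqP; rewrite -subr_eq0 mxE.
have := congr1 (@^~ z) (Smap_eqc i); rewrite /= Sz mxE => h.
apply/eqP; rewrite [RHS]h; congr (_ - _).
by apply: eq_bigr => k _; rewrite [A^T _ _]mxE.
Qed.

Let Smap_comp_hyperbola z j : S z = 0 ->
  0 < - gj j (px z) /\ 2 * (lam z j * - gj j (px z)) = eps ^+ 2.
Proof.
move=> Sz; apply: perturbed_FischerBurmeister_eq0 => //.
by have := congr1 (@^~ z) (Smap_comp j); rewrite /= Sz mxE => /esym.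
Qed.

Let ltilde_le l l' : 0 < l -> l <= l' -> ltilde l <= ltilde l'.
Proof.
move=> l0 ll'; rewrite /ltilde ler_pM2l// lerD// ler_wsqrtr// lerD2r.
by rewrite ler_sqr// nnegrE ltW// (lt_le_trans l0).
Qed.

(** Subtract the two stationarity equations and pair with w = x - x': strong monotonicity forces w =
    0 once the constraint terms have the right sign. The multipliers then follow from [x]. *)
Lemma Smap_zero_unique y z : S y = 0 -> S z = 0 -> y = z.
Proof.
move=> Sy Sz; have [stat_y stat_z] := (Smap_stat_vec Sy, Smap_stat_vec Sz).
set x := px y in stat_y; set x' := px z in stat_z; pose w := x - x'.
have wA : w *m A^T = 0 by rewrite mulmxBl !Smap_eqc_vec// subrr.
have dot_w (u : 'rV_m) : dot (u *m A) w = 0.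
  by rewrite dot_mulmxl wA dotC dot0l.
have hyp j : [/\ 0 < - gj j x, 0 < - gj j x', 0 < lam y j, 0 < lam z j &
    lam y j * - gj j x = lam z j * - gj j x'].
  have [gy ey] := Smap_comp_hyperbola j Sy.
  have [gz ez] := Smap_comp_hyperbola j Sz.
  rewrite -/x -/x' in gy ey gz ez.
  have e2 : 0 < eps ^+ 2 by rewrite exprn_gt0.
  split=> //; last by lra.
    by rewrite -(pmulr_lgt0 _ gy); lra.
  by rewrite -(pmulr_lgt0 _ gz); lra.
(* Both sides are separated by [gj j x - gj j x'] times either weight: the outer steps are convexity
   at each point, the middle one holds because the larger value of g_j comes with the larger
   lambda_j on the hyperbola. *)
have grad_le j : ltilde (lam z j) * dot (gradient (gj j) x') w <=
    ltilde (lam y j) * dot (gradient (gj j) x) w.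
  have [gy gz ly lz e] := hyp j.
  have := convex_gradient_ineq x' (@g_convex j) (gj_diff j x).
  have := convex_gradient_ineq x (@g_convex j) (gj_diff j x').
  rewrite !derive_dot_gradient; [|exact: gj_diff..].
  rewrite -(opprB x x') dotNl -/w !(dotC w) => gle' gle.
  have [t0 t0'] := (ltilde_gt0 (lam y j), ltilde_gt0 (lam z j)).
  apply: (@le_trans _ _ (ltilde (lam z j) * (gj j x - gj j x'))).
    by rewrite ler_pM2l.
  apply: (@le_trans _ _ (ltilde (lam y j) * (gj j x - gj j x'))); last first.
    by rewrite ler_pM2l// -lerN2 opprB.
  have [gg|gg] := leP (gj j x) (gj j x').
    rewrite ler_wnM2r ?subr_le0//; apply: ltilde_le => //.
    by rewrite -(ler_pM2r gy) e ler_pM2l// lerN2.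
  rewrite ler_wpM2r ?subr_ge0 ?(ltW gg)//; apply: ltilde_le => //.
  by rewrite -(ler_pM2r gz) -e ler_pM2l// lerN2 ltW.
have w0 : w = 0.
  have := congr1 (fun u => dot u w) stat_y.
  have := congr1 (fun u => dot u w) stat_z.
  rewrite /= !dot0l !dotDl !dot_suml !dot_w !addr0 => hz hy.
  have [c c_gt0 Fc] := F_mono; have := Fc x x'.
  rewrite -/w norm2_sqr dotBl => Fw.
  apply/eqP; rewrite -dot_eq0 eq_le dot_ge0 andbT -(pmulr_rle0 _ c_gt0).
  apply: le_trans Fw _.
  have : \sum_j dot (ltilde (lam z j) *: gradient (gj j) x') w <=
         \sum_j dot (ltilde (lam y j) *: gradient (gj j) x) w.
    by apply: ler_sum => j _; rewrite !dotZl.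
  by lra.
have xx : x = x' by apply/eqP; rewrite -subr_eq0 -/w w0.
(* At a common [x] the two hyperbola equations share the nonzero factor - g_j. *)
have ll j : lam y j = lam z j.
  by have [gy _ _ _] := hyp j; rewrite -xx => /mulIf; apply; rewrite gt_eqF.
have uu : rsubmx y = rsubmx z.
  apply: (row_free_inj A_free).
  move: stat_y; rewrite -[RHS]stat_z xx.
  by under eq_bigr do rewrite ll; move/addrI.
rewrite -[y]hsubmxK -[lsubmx y]hsubmxK -[z]hsubmxK -[lsubmx z]hsubmxK.
rewrite -/x -/x' xx uu; congr (row_mx (row_mx _ _) _).
by apply/rowP => j; rewrite !mxE ll.
Qed.

End Stationarity.

(** * Coordinates of the pseudo-gradient and application to the game *)

Lemma pseudo_gradientE {R : realType} N (d : 'I_N -> nat)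
    (J : 'I_N -> 'rV[R]_(\sum_i d i) -> R^o) x k :
  pseudo_gradient J x 0 k = 'D_(delta_mx 0 k) (J (tagnat.sig1 k)) x.
Proof. by rewrite !mxE tagnat.sig2K. Qed.

Theorem mainTheorem2 (R : realType)
    (N : nat) (d : 'I_N -> nat) (hN : (0 < N)%N) (hd : forall i, (0 < d i)%N)
    (p m : nat)
    (J : 'I_N -> 'rV[R]_(\sum_i d i) -> R^o)
    (g : 'rV[R]_(\sum_i d i) -> 'rV[R]_p)
    (A : 'M[R]_(m, \sum_i d i)) (b : 'rV[R]_m)
    (hF : strongly_monotone (pseudo_gradient J))
    (hJ : forall i, times_cont_diff 2 (J i))
    (hg : times_cont_diff 2 g)
    (hA : \rank A = m)
    (hconv : forall j, convex_function setT (fun x => g x 0 j))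
    (hSlater : exists2 xbar, xbar *m A^T = b & forall j, g xbar 0 j < 0)
    (hbnd : bounded_set [set x | x *m A^T = b /\ forall j, g x 0 j <= 0])
    (eps T mu_c : R) (heps : 0 < eps) (hT : 0 < T) (hmu : 0 < mu_c)
    (cstar : \bar R) (hcstar : (0 < cstar)%E)
    (hthreshold : forall c : R, 0 < c -> (c%:E < cstar)%E ->
       compact (Omega (pseudo_gradient J) g A b eps c))
    (z : R -> 'rV[R]_(\sum_i d i + p + m)) :
  let S := Smap (pseudo_gradient J) g A b eps in
  let V := Vfun (pseudo_gradient J) g A b eps in
  let Om := Omega (pseudo_gradient J) g A b eps in
  solution_flow V mu_c T z ->
  ((V (z 0))%:E < cstar)%E ->
  [/\ forall t, 0 <= t < T -> Om (V (z 0)) (z t),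
      exists sigma : R,
        [/\ is_minimum [set sigma_min (Jac S y) | y in Om (V (z 0))] sigma,
            0 < sigma &
            forall t, 0 <= t < T ->
              V (z t) <= V (z 0) * ((T - t) / T) `^ (2 * sigma ^+ 2 * mu_c)] &
      V (z t) @[t --> T^'-] --> (0 : R^o) /\
      exists zs, [/\ S zs = 0, forall y, S y = 0 -> y = zs &
                     z t @[t --> T^'-] --> zs]].
Proof.
move=> S V Om flow V0_lt.
(* Coordinate [k] of the pseudo-gradient is a partial derivative of the cost of agent
   [tagnat.sig1 k], the owner of that coordinate. *)
have C1F k : times_cont_diff 1 (fun x => pseudo_gradient J x 0 k : R^o).
  have [_ /(_ (delta_mx 0 k))] := hJ (tagnat.sig1 k).
  by congr (times_cont_diff 1 _); apply/funext => x; rewrite pseudo_gradientE.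
have A_free : row_free A by rewrite /row_free hA.
have dim_gt0 : (0 < \sum_i d i + p + m)%N.
  rewrite -addnA addn_gt0 lt0n sum_nat_eq0; apply/orP; left.
  by apply/forallPn; exists (Ordinal hN); rewrite -lt0n hd.
have V0_ge0 : 0 <= V (z 0) by exact: half_norm2_sqr_ge0.
(* A level strictly between [V (z 0)] and [cstar] is positive even when [V (z 0)] is 0, so the
   threshold hypothesis applies to it. *)
have [c V0c ccstar] : exists2 c : R, V (z 0) < c & (c%:E < cstar)%E.
  case: cstar V0_lt {hcstar hthreshold} => [r| |]//.
    rewrite lte_fin => V0r; exists ((V (z 0) + r) / 2).
      by rewrite midf_lt.
    by rewrite lte_fin midf_lt.
  by move=> _; exists (V (z 0) + 1); rewrite ?ltrDl// ltry.
(* The argument of [S] has blocks of sizes n, p, m and its value n, m, p: the Jacobian is square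
   only up to this equality. *)
have dim_eq : (\sum_i d i + m + p = \sum_i d i + p + m)%N by rewrite addnAC.
apply: (gradient_flow_converges dim_eq dim_gt0 _ _ hmu hT flow V0c).
- exact: C1_Smap.
- exact: Smap_Jac_inj.
- by apply: hthreshold => //; exact: le_lt_trans V0c.
- exact: Smap_zero_unique.
Qed.
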